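(* For all $x,y,z\in\mathcal{H}_{\mathcal{SPF}}^+$: $\langle x\prec y,z\rangle=\langle x\otimes y,\Delta'_\prec(z)\rangle$ and $\langle x\succ y,z\rangle=\langle x\otimes y,\Delta'_\succ(z)\rangle$.
   Context: $\mathbb{K}$ is a commutative field. A double poset is a finite set with two partial orders $(P,\leq_1,\leq_2)$, up to isomorphism; subsets are double posets by restriction. A plane poset is a double poset $(P,\leq_h,\leq_r)$ such that two distinct elements are comparable for $\leq_h$ if and only if they are not comparable for $\leq_r$; then $x\leq y$ iff ($x\leq_h y$ or $x\leq_r y$) is a total order. It is a plane forest if $(P,\leq_h)$ is a rooted forest with minimal elements as roots. A special plane forest is the double poset $(P,\leq_h,\leq)$ (so $\leq_1=\leq_h$, $\leq_2=\leq$) obtained from a plane forest. $\mathcal{H}_{\mathcal{SPF}}^+$ is the $\mathbb{K}$-vector space with basis the nonempty special plane forests. Product: $PQ$ is the disjoint union with $P,Q$ as subposets, $x\leq_2 y$ for $x\in P,y\in Q$, and no $\leq_1$-comparabilities between $P$ and $Q$ (concatenation of forests). Coproducts: for a nonempty special plane forest $P$, let $s_P$ be its smallest element for $\leq_2$; $\Delta'_\prec(P)$ (resp. $\Delta'_\succ(P)$) is $\sum_I (P\setminus I)\otimes I$ over the subsets $I\neq\emptyset,P$ such that ($x\in I$, $x\leq_1 y$ imply $y\in I$), with $s_P\notin I$ (resp. $s_P\in I$). Pairing: $\langle P,Q\rangle$ is the number of bijections $\sigma:P\to Q$ such that, for all $i,j\in P$, ($i\leq_1 j$ in $P$) implies ($\sigma(i)\leq_2\sigma(j)$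 in $Q$), and ($\sigma(i)\leq_1\sigma(j)$ in $Q$) implies ($i\leq_2 j$ in $P$); extended bilinearly, and $\langle x\otimes y,z\otimes t\rangle=\langle x,z\rangle\langle y,t\rangle$. Dendriform products: let $\bullet$ be the one-vertex tree and $B^+(F)$ the tree obtained by grafting the roots of the forest $F$ on a common new root (the new root being smallest for both orders; $B^+$ of the empty forest is $\bullet$; $B^+$ is extended linearly). $\prec,\succ$ are the products of the dendriform algebra structure on $\mathcal{H}_{\mathcal{SPF}}^+$ (i.e. $(x\prec y)\prec z=x\prec(yz)$, $(x\succ y)\prec z=x\succ(y\prec z)$, $(xy)\succ z=x\succ(y\succ z)$) such that $x\prec y+x\succ y=xy$ and $\bullet\prec F=B^+(F)$ for every nonempty $F$. They are determined recursively by: for a tree $T=B^+(A)$, $T\prec G=B^+(AG)$; for a forest $TF'$ with $T$ a tree and $F'$ nonempty, $(TF')\prec G=T\prec(F'G)+T(F'\prec G)-T\prec(F'\prec G)$; and $F\succ G=FG-F\prec G$. *)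

(* Defs.v *)
From HB Require Import structures.
From mathcomp Require Import all_boot all_algebra generic_quotient finmap.
From mathcomp Require Import monalg.

Set Implicit Arguments.
Unset Strict Implicit.
Unset Printing Implicit Defensive.

Import GRing.Theory.

Local Open Scope quotient_scope.
Local Open Scope ring_scope.

Definition porderb (T : finType) (r : rel T) : bool :=
  [&& [forall x, r x x],
      [forall x, forall y, r x y && r y x ==> (x == y)] &
      [forall y, forall x, forall z, r x y && r y z ==> r x z]].

Lemma porderP (T : finType) (r : rel T) :
  reflect [/\ reflexive r, antisymmetric r & transitive r] (porderb r).
Proof.
apply: (iffP and3P) => -[rxx ra rt]; split.
- exact/forallP.
- by move=> x y rxy; apply/eqP; move/forallP/(_ x)/forallP/(_ y)/implyP: ra; apply.
- move=> y x z rxy ryz.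
  by move/forallP/(_ y)/forallP/(_ x)/forallP/(_ z)/implyP: rt => -> //; rewrite rxy.
- exact/forallP.
- by apply/forallP=> x; apply/forallP=> y; apply/implyP=> /ra ->.
- apply/forallP=> y; apply/forallP=> x; apply/forallP=> z.
  by apply/implyP=> /andP[]; apply: rt.
Qed.

Record dposet := DPoset {
  dcar :> finType;
  le1 : rel dcar;
  le2 : rel dcar;
  le1_po : porderb le1;
  le2_po : porderb le2 }.

Definition bijb (T U : finType) (f : T -> U) : bool :=
  injectiveb f && [forall y, [exists x, f x == y]].

Definition diso (P Q : dposet) : bool :=
  [exists f : {ffun P -> Q}, bijb f &&
    [forall x, forall y, (le1 (f x) (f y) == le1 x y) &&
                         (le2 (f x) (f y) == le2 x y)]].

Lemma disoP (P Q : dposet) :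
  reflect (exists f : P -> Q, [/\ bijective f,
             forall x y, le1 (f x) (f y) = le1 x y &
             forall x y, le2 (f x) (f y) = le2 x y])
          (diso P Q).
Proof.
apply: (iffP existsP) => [[f /andP[/andP[/injectiveP fi /forallP fs]]]|].
  move=> /forallP fm; exists f; split.
  - have fs' y : exists x, f x == y by exact/existsP.
    exists (fun y => xchoose (fs' y)) => [x|y]; last exact/eqP/(xchooseP (fs' y)).
    by apply: fi; apply/eqP/(xchooseP (fs' (f x))).
  - by move=> x y; have /forallP/(_ y)/andP[/eqP] := fm x.
  - by move=> x y; have /forallP/(_ y)/andP[_ /eqP] := fm x.
case=> f [[g fK gK] f1 f2]; exists (finfun f); apply/andP; split.
  apply/andP; split.
    by apply/injectiveP=> x y; rewrite !ffunE => /(can_inj fK).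
  by apply/forallP=> y; apply/existsP; exists (g y); rewrite ffunE gK.
by apply/forallP=> x; apply/forallP=> y; rewrite !ffunE f1 f2 !eqxx.
Qed.

Lemma diso_refl P : diso P P.
Proof. by apply/disoP; exists id; split=> //; exists id. Qed.

Lemma diso_sym P Q : diso P Q -> diso Q P.
Proof.
case/disoP=> f [[g fK gK] f1 f2]; apply/disoP; exists g; split.
- by exists f.
- by move=> x y; rewrite -f1 !gK.
- by move=> x y; rewrite -f2 !gK.
Qed.

Lemma diso_trans P Q R : diso P Q -> diso Q R -> diso P R.
Proof.
case/disoP=> f [fb f1 f2] /disoP[g [gb g1 g2]]; apply/disoP.
exists (g \o f); split; first exact: bij_comp.
- by move=> x y /=; rewrite g1 f1.
- by move=> x y /=; rewrite g2 f2.
Qed.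

(* A type of isomorphism classes of double posets.  As [dposet] ranges over   *)
(* all finite types it is not itself a choiceType; every class has a          *)
(* representative on some 'I_n, so the classes form a quotient of [odposet].  *)
(* The quotient is only used through this interface: sealing it keeps         *)
(* unification from unfolding the underlying choice operators.                *)

Record iso_classes := IsoClasses {
  iso_sort : choiceType;
  iso_cls : dposet -> iso_sort;
  iso_rep : iso_sort -> dposet;
  iso_clsP : forall P Q, reflect (iso_cls P = iso_cls Q) (diso P Q);
  iso_repK : cancel iso_rep iso_cls }.

Definition oshape : Type :=
  {n : nat & ({ffun 'I_n * 'I_n -> bool} * {ffun 'I_n * 'I_n -> bool})%type}.

Definition odp_ok (s : oshape) : bool :=
  porderb (fun i j => (tagged s).1 (i, j)) &&
  porderb (fun i j => (tagged s).2 (i, j)).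

Definition odposet : Type := {s : oshape | odp_ok s}.

Definition dposet_of (s : odposet) : dposet :=
  DPoset (andP (valP s)).1 (andP (valP s)).2.

Definition diso_odp : rel odposet := fun s t => diso (dposet_of s) (dposet_of t).

Lemma diso_odp_equiv : equiv_class_of diso_odp.
Proof.
split=> [s|s t|t s u]; first exact: diso_refl.
  by apply/idP/idP; apply: diso_sym.
exact: diso_trans.
Qed.

Canonical diso_odp_equivrel := EquivRelPack diso_odp_equiv.

Lemma skeleton_po (T : finType) (r : rel T) : porderb r ->
  porderb (fun i j => [ffun p : 'I_#|T| * 'I_#|T| =>
                         r (enum_val p.1) (enum_val p.2)] (i, j)).
Proof.
case/porderP=> rr ra rt; apply/porderP; split=> [x|x y|y x z]; rewrite !ffunE //=.
  by move/ra/enum_val_inj.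
exact: rt.
Qed.

Definition skeleton_shape (P : dposet) : oshape :=
  Tagged (fun n => ({ffun 'I_n * 'I_n -> bool} * {ffun 'I_n * 'I_n -> bool})%type)
    ([ffun p : 'I_#|P| * 'I_#|P| => le1 (enum_val p.1) (enum_val p.2)],
     [ffun p : 'I_#|P| * 'I_#|P| => le2 (enum_val p.1) (enum_val p.2)]).

Lemma skeleton_ok (P : dposet) : odp_ok (skeleton_shape P).
Proof.
by apply/andP; split; apply: skeleton_po; [exact: le1_po | exact: le2_po].
Qed.

Definition skeleton (P : dposet) : odposet := Sub (skeleton_shape P) (skeleton_ok P).

Lemma skeleton_iso P : diso (dposet_of (skeleton P)) P.
Proof.
apply/disoP; exists (@enum_val P predT); split.
- by exists enum_rank; [exact: enum_valK | exact: enum_rankK].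
- by move=> x y /=; rewrite ffunE.
- by move=> x y /=; rewrite ffunE.
Qed.

Definition dposet_classes : iso_classes.
Proof.
pose cl P := \pi_({eq_quot diso_odp}) (skeleton P).
apply: (@IsoClasses {eq_quot diso_odp} cl (fun c => dposet_of (repr c))).
  move=> P Q; apply: (iffP idP) => [iPQ|/eqmodP iPQ].
    apply/eqmodP; apply: diso_trans (skeleton_iso P) _.
    exact: diso_trans iPQ (diso_sym (skeleton_iso Q)).
  apply: diso_trans (diso_sym (skeleton_iso P)) _.
  exact: diso_trans iPQ (skeleton_iso Q).
by move=> c; rewrite -[RHS]reprK; apply/eqmodP; exact: skeleton_iso.
Qed.

Definition dclass : Type := iso_sort dposet_classes.
HB.instance Definition _ := Choice.on dclass.

Definition cls (P : dposet) : dclass := iso_cls dposet_classes P.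
Definition rep (c : dclass) : dposet := iso_rep c.

Lemma clsP P Q : reflect (cls P = cls Q) (diso P Q).
Proof. exact: iso_clsP. Qed.

Lemma repK c : cls (rep c) = c.
Proof. exact: iso_repK. Qed.

Lemma cls_rep P : diso (rep (cls P)) P.
Proof. by apply/clsP; rewrite repK. Qed.

Definition dcard (c : dclass) : nat := #|rep c|.

Section Constructions.
Variables P Q : dposet.

Lemma restr_po (A : {set P}) (r : rel P) : porderb r ->
  porderb (fun x y : {x | x \in A} => r (val x) (val y)).
Proof.
case/porderP=> rr ra rt; apply/porderP; split=> [x|x y|y x z] //.
  by move/ra/val_inj.
exact: rt.
Qed.

Definition drestr (A : {set P}) : dposet :=
  DPoset (restr_po A (le1_po P)) (restr_po A (le2_po P)).

Definition sum_rel (b : bool) (r : rel P) (s : rel Q) : rel (P + Q)%type :=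
  fun x y => match x, y with
             | inl x, inl y => r x y
             | inr x, inr y => s x y
             | inl _, inr _ => b
             | inr _, inl _ => false
             end.

Lemma sum_po b (r : rel P) (s : rel Q) :
  porderb r -> porderb s -> porderb (sum_rel b r s).
Proof.
move=> /porderP[rr ra rt] /porderP[sr sa st]; apply/porderP; split.
- by case.
- by case=> x [] y //=; rewrite ?andbF //; by [move/ra-> | move/sa->].
- by case=> y [] x [] z //=; by [exact: rt | exact: st].
Qed.

Definition dprod : dposet :=
  DPoset (sum_po false (le1_po P) (le1_po Q)) (sum_po true (le2_po P) (le2_po Q)).

Definition graft_rel (r : rel P) : rel (option P) :=
  fun x y => match x, y with
             | None, _ => true
             | Some _, None => false
             | Some x, Some y => r x y
             end.

Lemma graft_po (r : rel P) : porderb r -> porderb (graft_rel r).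
Proof.
case/porderP=> rr ra rt; apply/porderP; split.
- by case.
- by case=> [x|] [y|] //= /ra ->.
- by case=> [y|] [x|] [z|] //=; exact: rt.
Qed.

Definition dgraft : dposet := DPoset (graft_po (le1_po P)) (graft_po (le2_po P)).

End Constructions.

Lemma void_po : porderb (fun _ _ : void => true).
Proof. by apply/porderP; split; case. Qed.

Definition dempty : dposet := DPoset void_po void_po.

Definition plane_poset (T : finType) (leh ler : rel T) : Prop :=
  [/\ porderb leh, porderb ler &
      forall x y, x != y -> (leh x y || leh y x) = ~~ (ler x y || ler y x)].

(* (T, le) is the order of a rooted forest, the minimal elements being the    *)
(* roots: the elements below a given one form a chain.                        *)
Definition rooted_forest_order (T : finType) (le : rel T) : Prop :=
  porderb le /\ forall x y z, le x z -> le y z -> le x y || le y x.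

Definition plane_forest (T : finType) (leh ler : rel T) : Prop :=
  plane_poset leh ler /\ rooted_forest_order leh.

Definition special_plane_forest (P : dposet) : Prop :=
  exists ler : rel P, plane_forest (@le1 P) ler /\
    forall x y, le2 x y = le1 x y || ler x y.

(* The monoid of classes of double posets; the algebra {malg K[dclass]} of    *)
(* this monoid has basis <<c>>, c : dclass, and its product is the            *)
(* concatenation of double posets.                                            *)

Definition cprod (c d : dclass) : dclass := cls (dprod (rep c) (rep d)).
Definition cempty : dclass := cls dempty.
Definition cgraft (c : dclass) : dclass := cls (dgraft (rep c)).

Lemma dprod_iso P P' Q Q' : diso P P' -> diso Q Q' -> diso (dprod P Q) (dprod P' Q').
Proof.
move=> /disoP[f [[f' fK fK'] f1 f2]] /disoP[g [[g' gK gK'] g1 g2]]; apply/disoP.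
exists (fun x : P + Q => match x with inl x => inl (f x) | inr x => inr (g x) end).
split; [|by case=> x [] y /=|by case=> x [] y /=].
by exists (fun x => match x with inl x => inl (f' x) | inr x => inr (g' x) end);
  case=> x; rewrite ?fK ?gK ?fK' ?gK'.
Qed.

Lemma dgraft_iso P P' : diso P P' -> diso (dgraft P) (dgraft P').
Proof.
move=> /disoP[f [[f' fK fK'] f1 f2]]; apply/disoP.
exists (omap f); split; [|by case=> [x|] [y|] /=|by case=> [x|] [y|] /=].
by exists (omap f'); case=> //= x; rewrite ?fK ?fK'.
Qed.

Lemma cprodE P Q : cprod (cls P) (cls Q) = cls (dprod P Q).
Proof. exact/clsP/dprod_iso/cls_rep/cls_rep. Qed.

Lemma cgraftE P : cgraft (cls P) = cls (dgraft P).
Proof. exact/clsP/dgraft_iso/cls_rep. Qed.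

Lemma dcardE P : dcard (cls P) = #|P|.
Proof. by have /disoP[f [/bij_eq_card]] := cls_rep P. Qed.

Lemma cprodA : associative cprod.
Proof.
move=> c d e; rewrite -[c]repK -[d]repK -[e]repK !cprodE; apply/clsP/disoP.
exists (fun x => match x with
  | inl a => inl (inl a) | inr (inl a) => inl (inr a) | inr (inr a) => inr a end).
split; [|by case=> [x|[x|x]] [y|[y|y]]|by case=> [x|[x|x]] [y|[y|y]]].
exists (fun x => match x with
  | inl (inl a) => inl a | inl (inr a) => inr (inl a) | inr a => inr (inr a) end).
  by case=> [x|[x|x]].
by case=> [[x|x]|x].
Qed.

Lemma cprod1 : left_id cempty cprod.
Proof.
move=> c; rewrite -[c]repK cprodE; apply/clsP/disoP.
exists (fun x : void + rep c => match x with inl a => match a with end | inr a => a end).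
by split; [exists inr => // -[]|case=> [[]|x] [[]|y]..].
Qed.

Lemma cprodr1 : right_id cempty cprod.
Proof.
move=> c; rewrite -[c]repK cprodE; apply/clsP/disoP.
exists (fun x : rep c + void => match x with inl a => a | inr a => match a with end end).
by split; [exists inl => // -[]|case=> [x|[]] [y|[]]..].
Qed.

Lemma dcard_prod c d : dcard (cprod c d) = (dcard c + dcard d)%N.
Proof. by rewrite dcardE card_sum. Qed.

Lemma dcard_empty : dcard cempty = 0%N.
Proof. by rewrite dcardE card_void. Qed.

Lemma dcard_graft c : dcard (cgraft c) = (dcard c).+1.
Proof. by rewrite dcardE card_option. Qed.

Lemma dcard_eq0 c : (dcard c == 0%N) = (c == cempty).
Proof.
apply/idP/eqP => [/eqP c0|->]; last by rewrite dcard_empty.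
have ff (x : rep c) : False by exact: fintype0 x c0.
rewrite -[c]repK; apply/clsP/disoP; exists (fun x => match ff x with end).
split; [|by move=> x; case: (ff x)|by move=> x; case: (ff x)].
by exists (fun x : void => match x with end) => x; [case: (ff x) | case: x].
Qed.

Lemma cprod_unit c d : cprod c d = cempty -> c = cempty /\ d = cempty.
Proof.
move/eqP; rewrite -dcard_eq0 dcard_prod addn_eq0 !dcard_eq0.
by case/andP=> /eqP -> /eqP ->.
Qed.

HB.instance Definition _ :=
  Choice_isMonomialDef.Build dclass cprodA cprod1 cprodr1 cprod_unit.

Section Algebra.
Variable K : fieldType.

Local Notation H := {malg K[dclass]}.
(* The tensor square of H: << (c, d) >> stands for c (x) d. *)
Local Notation H2 := {malg K[(dclass * dclass)%type]}.

Definition HSPFplus (x : H) : Prop :=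
  forall c, c \in msupp x -> special_plane_forest (rep c) /\ c <> cempty.

Definition lin (T : choiceType) (V : lmodType K) (f : T -> V) (x : {malg K[T]}) : V :=
  \sum_(c <- msupp x) x@_c *: f c.

Definition bilin (T U : choiceType) (V : lmodType K) (f : T -> U -> V)
    (x : {malg K[T]}) (y : {malg K[U]}) : V :=
  lin (fun c => lin (f c) y) x.

Definition Bplus : H -> H := lin (fun c => << cgraft c >>).

Definition leastb (P : dposet) (s : P) : bool := [forall y, le2 s y].

(* A nonempty special plane forest is P = T F', where T = B^+(A) is the tree  *)
(* whose root is the least element of P for le2.                              *)
Definition first_tree (P : dposet) : {set P} :=
  [set y | [exists s, leastb s && le1 s y]].
Definition cT (c : dclass) : dclass := cls (drestr (first_tree (rep c))).
Definition cA (c : dclass) : dclass :=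
  cls (drestr (first_tree (rep c) :\: [set s | leastb s])).
Definition cF' (c : dclass) : dclass := cls (drestr (~: first_tree (rep c))).

(* (T F') < d = B^+(A F' d) + T (F' < d) - B^+(A (F' < d)), since             *)
(* T < w = B^+(A w) for T = B^+(A).  Each step removes a tree, so the fuel n   *)
(* suffices when it is at least the number of trees of c.                      *)
Fixpoint prec_rec (n : nat) (c d : dclass) : H :=
  if n is m.+1 then
    if cF' c == cempty then << cgraft (cprod (cA c) d) >>
    else let w := prec_rec m (cF' c) d in
         << cgraft (cprod (cA c) (cprod (cF' c) d)) >>
         + << cT c >> * w - Bplus (<< cA c >> * w)
  else 0.

Definition dend_prec : H -> H -> H := bilin (fun c d => prec_rec (dcard c) c d).

Definition dend_succ (x y : H) : H := x * y - dend_prec x y.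

Definition ideal1 (P : dposet) (I : {set P}) : bool :=
  [forall x, forall y, (x \in I) && le1 x y ==> (y \in I)].

(* For I in a nonempty special plane forest P: s_P belongs to I. *)
Definition has_least (P : dposet) (I : {set P}) : bool :=
  [exists s in I, leastb s].

(* Only proper nonempty I occur, so P \ I and I are both nonempty; b tells    *)
(* whether s_P belongs to I.                                                  *)
Definition Delta_part (b : bool) (c : dclass) : H2 :=
  \sum_(I : {set rep c} | [&& I != set0, I != setT, ideal1 I & has_least I == b])
    << (cls (drestr (~: I)), cls (drestr I)) >>.

Definition Delta_prec : H -> H2 := lin (Delta_part false).
Definition Delta_succ : H -> H2 := lin (Delta_part true).

Definition tens : H -> H -> H2 := bilin (fun c d => << (c, d) >>).

Definition npictures (P Q : dposet) : nat :=
  #|[set f : {ffun P -> Q} | bijb f &&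
      [forall i, forall j, (le1 i j ==> le2 (f i) (f j)) &&
                           (le1 (f i) (f j) ==> le2 i j)]]|.

Definition cpair (c d : dclass) : K := (npictures (rep c) (rep d))%:R.

Definition pairing : H -> H -> K := bilin (V := K^o) cpair.

Definition pairing2 : H2 -> H2 -> K :=
  bilin (V := K^o) (fun p q => cpair p.1 q.1 * cpair p.2 q.2).

End Algebra.

(* The recursion above does define the dendriform structure of the space:     *)
(* lemmas dendriform_axioms and bullet_prec at the end of the file.           *)

Lemma drestr_iso (P Q : dposet) (A : {set P}) (f : Q -> P) :
  (forall y, reflect (exists x, y = f x) (y \in A)) ->
  (forall x y, le1 (f x) (f y) = le1 x y) ->
  (forall x y, le2 (f x) (f y) = le2 x y) -> diso Q (drestr A).
Proof.
move=> fA f1 f2.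
have fi : injective f.
  move=> x y fxy; have /porderP[r2 a2 _] := le2_po Q.
  by apply: a2; rewrite -!f2 -fxy f2 r2.
have fin x : f x \in A by apply/fA; exists x.
apply/disoP; exists (fun x => Sub (f x) (fin x)); split=> //.
apply: inj_card_bij => [x y [/fi]//|].
rewrite card_sig -(card_codom fi); apply/subset_leq_card/subsetP => y.
by rewrite inE => /fA[x ->]; apply/codomP; exists x.
Qed.

Lemma least_iso (P Q : dposet) (f : P -> Q) : bijective f ->
  (forall x y, le2 (f x) (f y) = le2 x y) -> forall x, leastb (f x) = leastb x.
Proof.
move=> [g fK gK] f2 x; apply/forallP/forallP => h y; last by rewrite -(gK y) f2.
by rewrite -f2.
Qed.

Lemma first_iso (P Q : dposet) (f : P -> Q) : bijective f ->
  (forall x y, le1 (f x) (f y) = le1 x y) ->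
  (forall x y, le2 (f x) (f y) = le2 x y) ->
  forall x, (f x \in first_tree Q) = (x \in first_tree P).
Proof.
move=> fb f1 f2 x; rewrite !inE; case: (fb) => g fK gK.
apply/existsP/existsP => -[s]; last by rewrite -(f1) -(least_iso fb f2); exists (f s).
by rewrite -{1 2}(gK s) f1 least_iso //; exists (g s).
Qed.

Lemma drestr_iso2 (P Q : dposet) (f : P -> Q) (A : {set P}) (B : {set Q}) : bijective f ->
  (forall x y, le1 (f x) (f y) = le1 x y) ->
  (forall x y, le2 (f x) (f y) = le2 x y) ->
  (forall x, (f x \in B) = (x \in A)) -> diso (drestr A) (drestr B).
Proof.
case=> g fK gK f1 f2 fAB.
apply: (@drestr_iso Q (drestr A) B (fun x => f (val x))) => [y|x y|x y]; rewrite ?f1 ?f2 //.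
apply: (iffP idP) => [|[[x xA] ->]]; last by rewrite fAB.
by rewrite -(gK y) fAB => yA; exists (Sub (g y) yA).
Qed.

Lemma cTE P : cT (cls P) = cls (drestr (first_tree P)).
Proof.
case/disoP: (cls_rep P) => f [fb f1 f2]; apply/clsP/(drestr_iso2 fb) => // x.
exact: first_iso.
Qed.

Lemma cAE P : cA (cls P) = cls (drestr (first_tree P :\: [set s | leastb s])).
Proof.
case/disoP: (cls_rep P) => f [fb f1 f2]; apply/clsP/(drestr_iso2 fb) => // x.
by rewrite in_setD first_iso // inE least_iso // in_setD !inE.
Qed.

Lemma cFE P : cF' (cls P) = cls (drestr (~: first_tree P)).
Proof.
case/disoP: (cls_rep P) => f [fb f1 f2]; apply/clsP/(drestr_iso2 fb) => // x.
by rewrite in_setC first_iso // in_setC.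
Qed.

Lemma least_uniq (P : dposet) (s t : P) : leastb s -> leastb t -> s = t.
Proof.
move=> /forallP/(_ t) st /forallP/(_ s) ts.
by have /porderP[_ a2 _] := le2_po P; apply: a2; rewrite st ts.
Qed.

Lemma first_least (P : dposet) (s : P) : leastb s -> first_tree P = [set y | le1 s y].
Proof.
move=> sl; apply/setP => y; rewrite !inE; apply/existsP/idP => [[t /andP[tl ty]]|sy].
  by rewrite (least_uniq sl tl).
by exists s; rewrite sl.
Qed.

Section Dec.
Variables a f : dposet.
Let P := dprod (dgraft a) f.
Let s : P := inl None.
Lemma sl : leastb s. Proof. by apply/forallP => -[[]|]. Qed.
Lemma lE (x : P) : leastb x = (x == s).
Proof. by apply/idP/eqP => [xl|->]; [exact: least_uniq xl sl | exact: sl]. Qed.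
Lemma dec_T : cT (cprod (cgraft (cls a)) (cls f)) = cgraft (cls a).
Proof.
rewrite cgraftE cprodE cTE; apply/esym/clsP.
apply: (@drestr_iso _ (dgraft a) _ (fun x => inl x : P)) => // y.
rewrite (first_least sl) inE; apply: (iffP idP) => [|[x ->]] //.
by case: y => y //= _; exists y.
Qed.
Lemma dec_A : cA (cprod (cgraft (cls a)) (cls f)) = cls a.
Proof.
rewrite cgraftE cprodE cAE; apply/esym/clsP.
apply: (@drestr_iso _ a _ (fun x => inl (Some x) : P)) => // y.
rewrite (first_least sl) in_setD !inE lE; apply: (iffP andP) => [|[x ->]] //.
by case: y => [[y|]|y] //= [] //= _ _; exists y.
Qed.
Lemma dec_F : cF' (cprod (cgraft (cls a)) (cls f)) = cls f.
Proof.
rewrite cgraftE cprodE cFE; apply/esym/clsP.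
apply: (@drestr_iso _ f _ (fun x => inr x : P)) => // y.
rewrite (first_least sl) in_setC inE; apply: (iffP idP) => [|[x ->]] //.
by case: y => y //= _; exists y.
Qed.
End Dec.

Lemma spf_iso P Q : diso P Q -> special_plane_forest P -> special_plane_forest Q.
Proof.
case/diso_sym/disoP=> g [[h gK hK] g1 g2] [ler [[[ph pr pc] [_ fc]] pe]].
exists (fun x y => ler (g x) (g y)); split; last by move=> x y; rewrite -g2 pe g1.
split; split; try exact: le1_po.
- case/porderP: pr => rr ra rt; apply/porderP; split=> [x|x y|y x z] //; last exact: rt.
  by move/ra/(can_inj gK).
- by move=> x y xy; rewrite -pc ?g1 // (inj_eq (can_inj gK)).
- by move=> x y z; rewrite -!g1; exact: fc.
Qed.

Lemma spf_restr (P : dposet) (A : {set P}) : special_plane_forest P -> special_plane_forest (drestr A).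
Proof.
case=> ler [[[ph pr pc] [_ fc]] pe].
exists (fun x y => ler (val x) (val y)); split; last by move=> x y; exact: pe.
split; split; try exact: le1_po.
- exact: restr_po.
- by move=> x y xy; apply: pc; rewrite (inj_eq val_inj).
- by move=> x y z; exact: fc.
Qed.

Lemma cF_spf c : special_plane_forest (rep c) -> special_plane_forest (rep (cF' c)).
Proof. by move=> h; apply: spf_iso (diso_sym (cls_rep _)) _; exact: spf_restr. Qed.

Lemma spf_decomp_aux (P : dposet) : special_plane_forest P -> cls P <> cempty ->
  cT (cls P) = cgraft (cA (cls P)) /\ cls P = cprod (cT (cls P)) (cF' (cls P)).
Proof.
move=> spf /eqP; rewrite -dcard_eq0 dcardE -lt0n => /card_gt0P[x0 _].
have [ler [[[ph pr pc] [_ fc]] pe]] := spf.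
have /porderP[r1 a1 t1] := le1_po P.
have /porderP[r2 a2 t2] := le2_po P.
have /porderP[rr ar tr] := pr.
have tot2 : total (@le2 P).
  move=> x y; case: (eqVneq x y) => [->|xy]; first by rewrite r2.
  rewrite !pe; have := pc _ _ xy.
  by case: (le1 x y); case: (le1 y x); case: (ler x y); case: (ler y x).
have [s sl] : exists s : P, leastb s.
  have [s _ sl] := arg_minnP (fun x : P => #|[set y | le2 y x]|) (isT : predT x0).
  exists s; apply/forallP => y; have [//|/negbTE nsy] := boolP (le2 s y).
  have ys : le2 y s by have := tot2 s y; rewrite nsy.
  have := sl y isT; rewrite leqNgt => /negP[]; apply/proper_card/properP; split.
    by apply/subsetP=> z; rewrite !inE => /t2; apply.
  by exists s; rewrite !inE ?nsy.
have sE x : leastb x = (x == s).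
  by apply/idP/eqP => [xl|->]; [exact: least_uniq xl sl | exact: sl].
have sl2 y : le2 s y by move/forallP: sl.
have ftE := first_least sl.
have n1s x : x != s -> le1 x s = false.
  move=> xs; apply/negP => l; case/eqP: xs; apply: a2.
  by rewrite (sl2 x) pe l.
split.
  rewrite cAE cTE cgraftE; apply/esym/clsP.
  apply: (@drestr_iso P (dgraft (drestr (first_tree P :\: [set s | leastb s]))) _
    (fun x => match x with None => s | Some x => val x end)).
  - move=> y; have -> : (y \in first_tree P) = le1 s y by rewrite ftE inE.
    apply: (iffP idP) => [sy|[[[x /= xP]|] ->]] //.
      have [->|ys] := eqVneq y s; first by exists None.
      have yP : y \in first_tree P :\: [set s0 | leastb s0].
        by rewrite in_setD ftE !inE sE ys.
      by exists (Some (exist _ y yP)).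
    by move: xP; rewrite in_setD ftE !inE => /andP[].
  - case=> [[x xP]|] [[y yP]|] //=; last by rewrite r1.
      by apply: n1s; move: xP; rewrite in_setD !inE sE => /andP[].
    by move: yP; rewrite in_setD ftE !inE => /andP[].
  - case=> [[x xP]|] [[y yP]|] //=; last by rewrite r2.
    2: by rewrite sl2.
    move: xP; rewrite in_setD !inE sE => /andP[xs _].
    by apply/negP => l; case/eqP: xs; apply: a2; rewrite l sl2.
rewrite cTE cFE cprodE; apply/esym/clsP.
have mixed x y : x \in first_tree P -> y \notin first_tree P ->
    [/\ le1 x y = false, le1 y x = false, le2 x y & le2 y x = false].
  rewrite ftE !inE => sx sy.
  have xy1 : le1 x y = false by apply/negP => /(t1 _ _ _ sx); apply/negP.
  have yx1 : le1 y x = false.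
    apply/negP => yx; have := fc _ _ _ yx sx.
    rewrite (negbTE sy) orbF n1s //; apply: contraNneq sy => ->; exact: r1.
  have nyx : y != x by apply: contraNneq sy => ->.
  have xy2 : le2 x y.
    have := tot2 x y; case/orP => // yx; exfalso.
    have sry : ler s y by move: (sl2 y); rewrite pe (negbTE sy).
    have yrx : ler y x by move: yx; rewrite pe yx1.
    have srx := tr _ _ _ sry yrx.
    have nsx : s != x.
      apply: contraNneq nyx => sxE; move: yrx; rewrite -sxE => yrs.
      by apply/eqP/ar; rewrite yrs sry.
    by have := pc _ _ nsx; rewrite sx srx.
  split=> //; apply/negP => yx2.
  by case/eqP: nyx; apply: a2; rewrite yx2 xy2.
apply/disoP.
exists (fun x => match x with inl x => val x | inr x => val x end).
split.
- apply: inj_card_bij; last by rewrite card_sum !card_sig -[X in (X <= _)%N](cardsC (first_tree P)); apply: eq_leq; congr addn; apply: eq_card.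
  case=> -[x xP] [] [y yP] /= xy; subst y.
  - by congr inl; apply: val_inj.
  - by exfalso; move: yP; rewrite in_setC xP.
  - by exfalso; move: xP; rewrite in_setC yP.
  - by congr inr; apply: val_inj.
- case=> -[x xP] [] [y yP] //=.
    by move: yP; rewrite in_setC => yP; case: (mixed _ _ xP yP).
  by move: xP; rewrite in_setC => xP; case: (mixed _ _ yP xP).
- case=> -[x xP] [] [y yP] //=.
    by move: yP; rewrite in_setC => yP; case: (mixed _ _ xP yP).
  by move: xP; rewrite in_setC => xP; case: (mixed _ _ yP xP).
Qed.


Lemma spf_decomp c : special_plane_forest (rep c) -> c <> cempty ->
  cT c = cgraft (cA c) /\ c = cprod (cT c) (cF' c).
Proof. by move=> h c0; have := @spf_decomp_aux (rep c) h; rewrite repK; exact. Qed.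

Section DendriformAxioms.
Variable K : fieldType.
Local Notation H := {malg K[dclass]}.
(* Abstract copies of the operators: matching on the concrete ones unfolds them. *)
Variables (B : H -> H) (BE : B = @Bplus K).
Variables (pr : H -> H -> H) (pE : pr = @dend_prec K).

Lemma linE (T : choiceType) (V : lmodType K) (f : T -> V) (x : {malg K[T]}) (A : {fset T}) :
  fsubset (msupp x) A -> lin f x = \sum_(c <- A) x@_c *: f c.
Proof.
move=> xA; rewrite /lin (big_fset_incl _ xA) //= => c _ cx.
by rewrite (mcoeff_outdom cx) scale0r.
Qed.

Lemma lin_linear (T : choiceType) (V : lmodType K) (f : T -> V) : linear (lin f).
Proof.
move=> a x y.
pose A := (msupp (a *: x + y) `|` (msupp x `|` msupp y))%fset.
rewrite !(@linE _ _ _ _ A) ?fsubsetUl //; last 2 first.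
- by rewrite /A fsetUA fsubsetUr.
- by rewrite /A fsetUCA fsubsetUl.
rewrite scaler_sumr -big_split /=; apply: eq_bigr => c _.
by rewrite mcoeffD mcoeffZ scalerDl scalerA.
Qed.
HB.instance Definition _ (T : choiceType) (V : lmodType K) (f : T -> V) :=
  GRing.isLinear.Build K {malg K[T]} V *:%R (lin f) (lin_linear f).

Lemma linU (T : choiceType) (V : lmodType K) (f : T -> V) (c : T) :
  lin f << c >> = f c.
Proof. by rewrite /lin msuppU oner_eq0 big_seq_fset1 mcoeffU eqxx scale1r. Qed.


Lemma BU c : B << c >> = << cgraft c >>. Proof. by rewrite BE; exact: linU. Qed.


Lemma BD (x y : H) : B (x + y) = B x + B y. Proof. by rewrite BE /Bplus linearD. Qed.
Lemma BN (x : H) : B (- x) = - B x. Proof. by rewrite BE /Bplus linearN. Qed.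
Lemma BZ k (x : H) : B (k *: x) = k *: B x. Proof. by rewrite BE /Bplus linearZ. Qed.
Lemma B0 : B 0 = 0. Proof. by rewrite BE /Bplus linear0. Qed.
Lemma addrB_ACA (V : zmodType) (a b c d e f : V) :
  (a + b - c) + (d + e - f) = (a + d) + (b + e) - (c + f).
Proof. by rewrite opprD addrACA [a + b + _]addrACA. Qed.

Lemma mulU (c d : dclass) : << c >> * << d >> = << cprod c d >> :> H.
Proof.
rewrite /GRing.mul /=.
have -> : 1 = 1 * 1 :> K by rewrite mulr1.
by rewrite -fgmulUU mulr1.
Qed.

Lemma malgAr (k : K) (x y : H) : x * (k *: y) = k *: (x * y).
Proof.
apply/malgP=> m; rewrite [RHS]mcoeffZ.
rewrite [LHS](mcoeffMlw _ (fsubset_refl (msupp x)) (msuppZ_le k y)).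
rewrite (mcoeffMl x y m).
rewrite mulr_sumr; apply: eq_bigr => c _; rewrite mulr_sumr; apply: eq_bigr => d _.
by rewrite (mcoeffZ k y) mulrnAr mulrCA.
Qed.

Lemma bilin_linear_r (T U : choiceType) (V : lmodType K) (f : T -> U -> V) x :
  linear (bilin f x).
Proof.
move=> a y z; rewrite /bilin {1 3 5}/lin scaler_sumr -big_split /=; apply: eq_bigr => c _.
by rewrite linearP scalerDr !scalerA (mulrC a).
Qed.
HB.instance Definition _ (T U : choiceType) (V : lmodType K) (f : T -> U -> V) x :=
  GRing.isLinear.Build K {malg K[U]} V *:%R (bilin f x) (bilin_linear_r f x).
Lemma bilin_linear_l (T U : choiceType) (V : lmodType K) (f : T -> U -> V) y :
  linear ((bilin f)^~ y).
Proof. by move=> a x z; rewrite /bilin linearP. Qed.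

Lemma precDl (x y z : H) : pr (x + y) z = pr x z + pr y z.
Proof. rewrite pE; by have := bilin_linear_l (fun c d => prec_rec K (dcard c) c d) z 1 x y; rewrite !scale1r. Qed.
Lemma precZl a (x z : H) : pr (a *: x) z = a *: pr x z.
Proof.
have h := bilin_linear_l (fun c d => prec_rec K (dcard c) c d) z a x 0.
by rewrite pE; move: h; rewrite /dend_prec addr0 => ->; rewrite [X in _ + X]/bilin linear0 addr0.
Qed.
Lemma precDr (x y z : H) : pr x (y + z) = pr x y + pr x z.
Proof. by rewrite pE /dend_prec linearD. Qed.
Lemma precZr a (x z : H) : pr x (a *: z) = a *: pr x z.
Proof. by rewrite pE /dend_prec linearZ. Qed.
Lemma prec0l (z : H) : pr 0 z = 0.
Proof. by rewrite -[0](scale0r 0) precZl !scale0r. Qed.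
Lemma prec0r (z : H) : pr z 0 = 0.
Proof. by rewrite -[0](scale0r 0) precZr !scale0r. Qed.
Lemma precUU c d : pr << c >> << d >> = prec_rec K (dcard c) c d.
Proof. by rewrite pE /dend_prec /bilin !linU. Qed.

Inductive isF : dclass -> Prop :=
| isF0 : isF cempty
| isFS a f of isF f : isF (cprod (cgraft a) f).

Lemma spf_isF c : special_plane_forest (rep c) -> isF c.
Proof.
have [n] := ubnP (dcard c); elim: n c => // n IHn c cn spf.
have [->|/eqP c0] := eqVneq c cempty; first exact: isF0.
have [TE cE] := spf_decomp spf c0.
rewrite cE TE; apply/isFS/IHn; last exact: cF_spf.
by move: cn; rewrite [X in dcard X]cE TE dcard_prod dcard_graft addSn ltnS; apply: leq_trans; rewrite ltnS leq_addl.
Qed.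

Lemma decT a f : cT (cprod (cgraft a) f) = cgraft a.
Proof. by rewrite -[a]repK -[f]repK dec_T. Qed.
Lemma decA a f : cA (cprod (cgraft a) f) = a.
Proof. by rewrite -[a]repK -[f]repK dec_A. Qed.
Lemma decF a f : cF' (cprod (cgraft a) f) = f.
Proof. by rewrite -[a]repK -[f]repK dec_F. Qed.

Lemma prec_recS n a f d :
  prec_rec K n.+1 (cprod (cgraft a) f) d =
    if f == cempty then << cgraft (cprod a d) >>
    else << cgraft (cprod a (cprod f d)) >> + << cgraft a >> * prec_rec K n f d
         - B (<< a >> * prec_rec K n f d).
Proof. by rewrite [LHS]/= BE decA decF decT. Qed.

Lemma prec_fuel c : isF c -> c <> cempty -> forall n d, (dcard c <= n)%N ->
  prec_rec K n c d = prec_rec K (dcard c) c d.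
Proof.
elim=> [[]|a f Ff IHf _ n d]; first by [].
rewrite dcard_prod dcard_graft addSn; case: n => [|n]; first by rewrite ltn0.
rewrite ltnS => ln; rewrite !prec_recS.
have [_|/eqP f0] := eqVneq f cempty; first by [].
rewrite (IHf f0 n) ?(IHf f0 (_ + _)%N); first by [].
  exact: leq_addl.
exact: leq_trans (leq_addl _ _) ln.
Qed.

Lemma prec_one (z : H) : pr 1 z = 0.
Proof.
rewrite pE /dend_prec /bilin linU dcard_empty /lin big1 // => c _.
exact: scaler0.
Qed.

Inductive inF : H -> Prop :=
| inF0 : inF 0
| inFU c of isF c : inF << c >>
| inFD x y of inF x & inF y : inF (x + y)
| inFZ k x of inF x : inF (k *: x).

Lemma HSPFplus_inF x : HSPFplus x -> inF x.
Proof.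
move=> h; rewrite (monalgE x) big_seq; apply: big_ind => [|u v|c cx].
- exact: inF0.
- exact: inFD.
have -> : << x@_c *g c >> = x@_c *: << c >> :> H.
  by apply/malgP => d; rewrite mcoeffZ !mcoeffU mulr_natr.
by apply/inFZ/inFU/spf_isF; have [] := h c cx.
Qed.

Lemma malg_ind (P : H -> Prop) : P 0 -> (forall c, P << c >>) ->
  (forall x y, P x -> P y -> P (x + y)) -> (forall k x, P x -> P (k *: x)) ->
  forall x, P x.
Proof.
move=> P0 PU PD PZ x; rewrite (monalgE x); apply: big_ind => // c _.
have -> : << x@_c *g c >> = x@_c *: << c >> :> H.
  by apply/malgP => d; rewrite mcoeffZ !mcoeffU mulr_natr.
exact: PZ.
Qed.

Lemma prec_stepU a f z : isF f ->
  pr (<< cgraft a >> * << f >>) z =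
  B (<< a >> * (<< f >> * z)) + << cgraft a >> * pr << f >> z
  - B (<< a >> * pr << f >> z).
Proof.
move=> Ff; elim/malg_ind: z => [|d|x y IHx IHy|k x IHx].
- by rewrite !prec0r !mulr0 B0 subr0 addr0.
- rewrite !mulU BU !precUU dcard_prod dcard_graft addSn prec_recS.
  case: eqVneq => [->|/eqP f0].
    by rewrite dcard_empty /= !mulr0 B0 subr0 addr0 cprod1.
  by rewrite (prec_fuel Ff f0) ?leq_addl.
- by rewrite !precDr IHx IHy !mulrDr !BD addrB_ACA.
- by rewrite !precZr IHx !malgAr !BZ scalerBr scalerDr.
Qed.

Lemma prec_step a (w z : H) : inF w ->
  pr (<< cgraft a >> * w) z =
  B (<< a >> * (w * z)) + << cgraft a >> * pr w z - B (<< a >> * pr w z).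
Proof.
elim=> [|c Fc|x y _ IHx _ IHy|k x _ IHx].
- by rewrite !(mulr0, mul0r, prec0l) B0 subr0 addr0.
- exact: prec_stepU.
- rewrite !(mulrDr, mulrDl, precDl) IHx IHy !BD; exact: addrB_ACA.
- by rewrite !(malgAr, =^~ scalerAl, precZl) IHx !BZ scalerBr scalerDr.
Qed.

Lemma prec_B (u z : H) : pr (B u) z = B (u * z).
Proof.
elim/malg_ind: u => [|d|x y IHx IHy|k x IHx].
- by rewrite mul0r B0 prec0l.
- rewrite BU -[<< cgraft d >>]mulr1 prec_step; last exact/inFU/isF0.
  by rewrite prec_one !mulr0 B0 mul1r subr0 addr0.
- by rewrite mulrDl !BD precDl IHx IHy.
- by rewrite -scalerAl !BZ precZl IHx.
Qed.

Lemma inF_B u : inF (B u).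
Proof.
elim/malg_ind: u => [|d|x y IHx IHy|k x IHx]; rewrite ?(B0, BD, BZ).
- exact: inF0.
- by rewrite BU -[cgraft d]cprodr1; apply/inFU/isFS/isF0.
- exact: inFD.
- exact: inFZ.
Qed.

Lemma isF_prod c d : isF c -> isF d -> isF (cprod c d).
Proof. by elim=> [|a f Ff IHf] Fd; rewrite ?cprod1 // -cprodA; apply/isFS/IHf. Qed.

Lemma inF_mul x y : inF x -> inF y -> inF (x * y).
Proof.
move=> Fx; elim=> [|d Fd|y1 y2 _ IH1 _ IH2|k y' _ IH]; rewrite ?(mulr0, mulrDr, malgAr).
- exact: inF0.
- elim: Fx => [|c Fc|y1 y2 _ IH1 _ IH2|k y' _ IH]; rewrite ?(mul0r, mulrDl, =^~scalerAl).
  + exact: inF0.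
  + by rewrite mulU; apply/inFU/isF_prod.
  + exact: inFD.
  + exact: inFZ.
- exact: inFD.
- exact: inFZ.
Qed.

Lemma inFN x : inF x -> inF (- x).
Proof. by move/(inFZ (-1)); rewrite scaleN1r. Qed.

Lemma isF_tree a : isF (cgraft a).
Proof. by rewrite -[cgraft a]cprodr1; apply/isFS/isF0. Qed.

Lemma inF_prec x y : inF x -> inF y -> inF (pr x y).
Proof.
move=> Fx Fy; elim: Fx => [|c Fc|y1 y2 _ IH1 _ IH2|k y' _ IH]; rewrite ?(prec0l, precDl, precZl).
- exact: inF0.
- elim: Fc => [|a f Ff IHf]; first by rewrite prec_one; exact: inF0.
  rewrite -mulU prec_stepU //; apply: inFD; last exact/inFN/inF_B.
  by apply: inFD; [exact: inF_B | apply: inF_mul => //; exact/inFU/isF_tree].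
- exact: inFD.
- exact: inFZ.
Qed.

Lemma addr_dend1 (V : zmodType) (X u v w : V) : X + (u - v + w) - u = X + w - v.
Proof. by rewrite -addrA -[u - v + w]addrA [u + _]addrC addrK addrA addrAC. Qed.

Lemma addr_dend2 (V : zmodType) (X p q r s t u : V) :
  X + (p + q - r) - (s + t - u) = X + p - s + q - (t + r - u).
Proof. by rewrite !opprD !opprK !addrA [LHS](ACl (1*2*5*3*6*4*7))%AC. Qed.

Lemma prec_prec x y z : inF x -> inF y -> pr (pr x y) z = pr x (y * z).
Proof.
move=> Fx Fy; elim: Fx => [|c Fc|y1 y2 _ IH1 _ IH2|k y' _ IH]; rewrite ?(prec0l, precDl, precZl) ?IH1 ?IH2 ?IH //.
elim: Fc => [|a f Ff IHf]; first by rewrite !prec_one prec0l.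
rewrite -!mulU !prec_stepU // !(precDl, precZl) -scaleN1r precZl !prec_B.
rewrite prec_step; last by apply: inF_prec => //; exact: inFU.
rewrite scaleN1r IHf -!mulrA [X in _ + X - _]addrAC.
exact: addr_dend1.
Qed.

Lemma prec_mul x y z : inF x -> inF y -> inF z ->
  pr (x * y) z = pr x (y * z) + x * pr y z - pr x (pr y z).
Proof.
move=> Fx Fy Fz; elim: Fx => [|c Fc|y1 y2 _ IH1 _ IH2|k y' _ IH].
- by rewrite !(mul0r, prec0l) subr0 addr0.
- elim: Fc => [|a f Ff IHf]; first by rewrite !prec_one !mul1r add0r subr0.
  rewrite -!mulU -mulrA prec_step; last by apply: inF_mul => //; exact: inFU.
  rewrite !prec_stepU // IHf !(mulrDr, mulrN) !(BD, BN) !mulrA.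
  exact: addr_dend2.
- rewrite !(mulrDl, precDl) IH1 IH2; exact: addrB_ACA.
- by rewrite -!scalerAl !precZl IH scalerBr scalerDr.
Qed.

Local Notation sc x y := (x * y - pr x y).
Lemma dendriform_inF x y z : inF x -> inF y -> inF z ->
  [/\ pr (pr x y) z = pr x (y * z),
      pr (sc x y) z = sc x (pr y z) &
      sc (x * y) z = sc x (sc y z)].
Proof.
move=> Fx Fy Fz; have h1 := prec_prec z Fx Fy; have h2 := prec_mul Fx Fy Fz.
split=> //.
- by rewrite -[- pr x y]scaleN1r precDl precZl scaleN1r h1 h2 -addrA -addrA [LHS]addrC -addrA addrNK.
- rewrite h2 mulrBr -[X in pr x (y * z - X)]scale1r -scaleNr precDr precZr scaleN1r.
  rewrite !opprD !opprK mulrA -!addrA; congr (_ + _); rewrite [LHS]addrCA; by [].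
Qed.

Lemma bullet_prec_aux F : pr << cgraft cempty >> F = B F.
Proof. by rewrite -BU prec_B mul1r. Qed.
End DendriformAxioms.

Section Dendriform.
Variable K : fieldType.
Implicit Types x y z : {malg K[dclass]}.

Lemma dendriform_axioms x y z : HSPFplus x -> HSPFplus y -> HSPFplus z ->
  [/\ dend_prec (dend_prec x y) z = dend_prec x (y * z),
      dend_prec (dend_succ x y) z = dend_succ x (dend_prec y z) &
      dend_succ (x * y) z = dend_succ x (dend_succ y z)].
Proof.
move=> /HSPFplus_inF Fx /HSPFplus_inF Fy /HSPFplus_inF Fz.
exact: (dendriform_inF (erefl (@Bplus K)) (erefl (@dend_prec K))).
Qed.

Lemma dend_precDsucc x y : dend_prec x y + dend_succ x y = x * y.
Proof. by rewrite /dend_succ addrC subrK. Qed.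

Lemma bullet_prec x : dend_prec << cgraft cempty >> x = Bplus x.
Proof. exact: (bullet_prec_aux (erefl (@Bplus K)) (erefl (@dend_prec K))). Qed.

End Dendriform.

(* Main.v *)
Require Import Defs.
From mathcomp Require Import all_boot all_algebra monalg.

Local Open Scope ring_scope.

Set Implicit Arguments.
Unset Strict Implicit.
Unset Printing Implicit Defensive.
Import GRing.Theory.

(** Fix a double poset Z and count the pictures from a forest onto a subset A of
Z; this gives a linear form [picture_form A] on the algebra.  All of them, for
varying A, are handled at once, because coproducts of Z only involve its
subsets, and they behave well with respect to the two operations from which
[dend_prec] is built.

- A picture from a concatenation xy onto A is the same as an ideal I of A with
  a picture from x onto A \ I and one from y onto I
  ([picture_form_mul]): the product is dual to the full coproduct.
- If A has a least element s for [le2] and [le1] is contained in [le2], as in a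
  special plane forest, a picture from B(x) onto A must send
  the root to s, so it is the same as a picture from x onto A \ s
  ([picture_form_graft]): grafting is dual to removing the least element.

Write c = B(a) f, with f a smaller forest.  The recursion for [dend_prec] reads
c < d = B(a (fd - f < d)) + B(a) (f < d).  Applying the two facts to both terms,
the first one becomes a sum over the ideals J of A avoiding s, the second one a
sum over all ideals J of A, with the same weight
[picture_form (A \ J) (B a)].  The terms f < d cancel on the J avoiding s, where
only fd is left; on the J containing s the induction hypothesis applies, since s
is still least in J.  In both cases what remains is the sum over the ideals I of
J that avoid s.  Exchanging the sums over J and I
(coassociativity, [sum_ideal_chain]) gathers B(a) and f into c and gives

  form A (c < d) = sum of form (A \ I) c * form I d over the ideals I of A
                   that avoid s,

which is [picture_form_prec].  For A = Z this is the first identity on basis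
elements.  The second one is its difference with the identity for the product. *)

(** * Ideals and the coassociativity of cutting *)

Section Ideals.
Variable Z : dposet.
Implicit Types A I J : {set Z}.

Definition ideal_in A I :=
  (I \subset A) && [forall x in I, forall y in A, le1 x y ==> (y \in I)].

Lemma ideal_inP A I :
  reflect (I \subset A /\ forall x y, x \in I -> y \in A -> le1 x y -> y \in I)
          (ideal_in A I).
Proof.
apply: (iffP andP) => -[IA].
  move/forall_inP=> h; split=> // x y xI yA xy.
  by have /forall_inP/(_ y yA)/implyP := h x xI; apply.
move=> h; split=> //; apply/forall_inP=> x xI; apply/forall_inP=> y yA.
by apply/implyP; apply: h.
Qed.

Lemma ideal_in_setT I : ideal_in setT I = ideal1 I.
Proof.
apply/ideal_inP/forallP => [[_ h] x|h].
  by apply/forallP=> y; apply/implyP=> /andP[xI]; apply: h.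
split=> [|x y xI _ xy]; first exact: subsetT.
by have /forallP/(_ y)/implyP := h x; apply; rewrite xI.
Qed.

(** Two nested cuts may be made in either order: J first and then I inside J, or
I first and then J \ I inside A \ I. *)
Lemma ideal_chain A I J : I \subset J -> J \subset A ->
  (ideal_in A J && ideal_in J I) = (ideal_in A I && ideal_in (A :\: I) (J :\: I)).
Proof.
move=> IJ JA; apply/andP/andP => -[/ideal_inP[_ h1] /ideal_inP[_ h2]]; split.
- apply/ideal_inP; split; first exact: subset_trans IJ JA.
  by move=> x y xI yA xy; apply: (h2 x) => //; apply: (h1 x) => //; apply: (subsetP IJ).
- apply/ideal_inP; split=> [|x y]; first exact: setSD.
  by rewrite !inE => /andP[_ xJ] /andP[-> yA] /(h1 _ _ xJ yA).
- apply/ideal_inP; split=> // x y xJ yA xy.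
  have [xI|xI] := boolP (x \in I); first exact/(subsetP IJ)/(h1 x).
  have [|yI] := boolP (y \in I); first exact: (subsetP IJ).
  by have := h2 x y; rewrite !inE xI xJ yI yA => /(_ isT isT xy).
- by apply/ideal_inP; split=> // x y xI /(subsetP JA) yA; apply: h1.
Qed.

Lemma sum_ideal_chain (V : nmodType) A (u : {set Z} -> {set Z} -> {set Z} -> V) :
  \sum_(J | ideal_in A J) \sum_(I | ideal_in J I) u (A :\: J) (J :\: I) I =
  \sum_(I | ideal_in A I) \sum_(J | ideal_in (A :\: I) J) u (A :\: I :\: J) J I.
Proof.
rewrite (exchange_big_dep (ideal_in A)) /=; last first.
  move=> J I AJ JI; have /ideal_inP[JA _] := AJ; have /ideal_inP[IJ _] := JI.
  by have := ideal_chain IJ JA; rewrite AJ JI => /esym/andP[].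
apply: eq_bigr => I AI.
rewrite (reindex_onto (fun J => J :|: I) (fun J => J :\: I)) /=; last first.
  move=> J /andP[_ /ideal_inP[IJ _]].
  by apply/setP=> x; rewrite !inE; have := subsetP IJ x; case: (x \in I) => /= [->|_]; rewrite ?orbF.
apply: eq_big => J.
  apply/andP/idP => [[/andP[AJ JI] /eqP JE]|AJ].
    have /ideal_inP[JA _] := AJ; have /ideal_inP[IJ _] := JI.
    by have := ideal_chain IJ JA; rewrite AJ JI JE => /esym/andP[].
  have /ideal_inP[JAI _] := AJ.
  have JE : (J :|: I) :\: I = J.
    apply/setP=> x; rewrite !inE; have := subsetP JAI x; rewrite !inE.
    by case: (x \in I); case: (x \in J) => //= /(_ isT).
  split; last by rewrite JE.
  rewrite ideal_chain ?subsetUr ?JE ?AI // subUset; have /ideal_inP[-> _] := AI.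
  by rewrite andbT (subset_trans JAI) // subsetDl.
case/andP=> _ /eqP JE; rewrite JE.
by congr u; rewrite setUC setDDl.
Qed.

Definition least_in A (s : Z) := (s \in A) && [forall y in A, le2 s y].

Lemma least_inP A s :
  reflect (s \in A /\ forall y, y \in A -> le2 s y) (least_in A s).
Proof. by apply: (iffP andP) => -[sA /forall_inP]. Qed.

Lemma least_in_sub A J s : J \subset A -> s \in J -> least_in A s -> least_in J s.
Proof.
move=> JA sJ /least_inP[_ h]; apply/least_inP; split=> // y yJ.
exact/h/(subsetP JA).
Qed.

(** The least element s is minimal for [le1] as well, so putting it back into the
ambient set does not affect upward closure. *)
Lemma ideal_in_D1 A J s : (forall x y : Z, le1 x y -> le2 x y) -> least_in A s ->
  ideal_in (A :\ s) J = ideal_in A J && (s \notin J).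
Proof.
move=> le12 /least_inP[sA sl].
apply/ideal_inP/andP => [[JA h]|[/ideal_inP[JA h] sJ]].
  have sJ : s \notin J by apply/negP=> /(subsetP JA); rewrite !inE eqxx.
  split=> //; apply/ideal_inP; split=> [|x y xJ yA xy].
    exact: subset_trans JA (subsetDl _ _).
  have := subsetP JA x xJ; rewrite !inE => /andP[xs xA].
  have [ys|ys] := eqVneq y s; last by apply: (h x); rewrite ?inE ?ys.
  have /porderP[_ a2 _] := le2_po Z.
  case/eqP: xs; apply: a2; rewrite sl // andbT; apply: le12; by rewrite -ys.
split=> [|x y xJ]; first by rewrite subsetD1 JA.
by rewrite !inE => /andP[_ yA]; apply: h.
Qed.

End Ideals.

(** * Pictures onto a subset *)

Section Pictures.
Variable Z : dposet.
Implicit Types (P Q : dposet) (A I J : {set Z}).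

(** Unlike in [npictures] the target is a subset of a fixed double poset and
injectivity is left out: the second condition and the antisymmetry of [le2] imply
it ([picture_inj]). *)
Definition pictures P A : {set {ffun P -> Z}} :=
  [set f : {ffun P -> Z} | (f @: setT == A) &&
    [forall i, forall j, (le1 i j ==> le2 (f i) (f j)) &&
                         (le1 (f i) (f j) ==> le2 i j)]].

Lemma picturesP P A (f : {ffun P -> Z}) :
  reflect [/\ f @: setT = A, forall i j, le1 i j -> le2 (f i) (f j) &
              forall i j, le1 (f i) (f j) -> le2 i j]
          (f \in pictures P A).
Proof.
rewrite inE; apply: (iffP andP) => [[/eqP fA h]|[fA h1 h2]]; split=> //.
- by move=> i j; move/forallP/(_ i)/forallP/(_ j)/andP: h => [/implyP].
- by move=> i j; move/forallP/(_ i)/forallP/(_ j)/andP: h => [_ /implyP].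
- exact/eqP.
- by apply/forallP=> i; apply/forallP=> j; apply/andP; split; apply/implyP; auto.
Qed.

Lemma picture_inj P A (f : {ffun P -> Z}) : f \in pictures P A -> injective f.
Proof.
case/picturesP=> _ _ h i j fij.
have /porderP[_ a2 _] := le2_po P; have /porderP[r1 _ _] := le1_po Z.
by apply: a2; rewrite !h // fij r1.
Qed.

Lemma picture_in P A (f : {ffun P -> Z}) i : f \in pictures P A -> f i \in A.
Proof. by case/picturesP=> <- _ _; apply: imset_f. Qed.

(** Lets the abstract representative of a restriction be replaced by the subset
itself. *)
Lemma card_pictures P Q A (g : Q -> Z) :
  g @: setT = A ->
  (forall x y, le1 (g x) (g y) = le1 x y) ->
  (forall x y, le2 (g x) (g y) = le2 x y) ->
  npictures P Q = #|pictures P A|.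
Proof.
move=> gA g1 g2.
have gi : injective g.
  move=> x y gxy; have /porderP[r2 a2 _] := le2_po Q.
  by apply: a2; rewrite -!g2 gxy; have /porderP[-> _ _] := le2_po Z.
rewrite /npictures.
rewrite -(card_imset _ (_ : injective (fun f : {ffun P -> Q} => [ffun i => g (f i)]))).
  apply: eq_card => h; apply/imsetP/idP => [[f + ->]|hP].
    rewrite inE => /andP[/andP[_ /forallP fs] /forallP fm]; apply/picturesP; split.
    - apply/setP=> z; rewrite -gA; apply/imsetP/imsetP => -[x _ ->].
        by exists (f x); rewrite ?ffunE.
      by have /existsP[i /eqP <-] := fs x; exists i; rewrite ?ffunE.
    - by move=> i j; rewrite !ffunE g2; have /forallP/(_ j)/andP[/implyP] := fm i.
    - by move=> i j; rewrite !ffunE g1; have /forallP/(_ j)/andP[_ /implyP] := fm i.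
  have hg i : exists x, g x == h i.
    by have := picture_in i hP; rewrite -gA => /imsetP[x _ ->]; exists x.
  have [f hE] : exists f : {ffun P -> Q}, forall i, h i = g (f i).
    exists [ffun i => xchoose (hg i)] => i.
    by rewrite ffunE; apply/esym/eqP/(xchooseP (hg i)).
  exists f; last by apply/ffunP=> i; rewrite ffunE.
  have hi := picture_inj hP.
  case/picturesP: hP => hA h1 h2.
  rewrite inE /bijb; apply/andP; split; first (apply/andP; split).
  - by apply/injectiveP=> i j fij; apply: hi; rewrite !hE fij.
  - apply/forallP=> x; have : g x \in A by rewrite -gA imset_f.
    rewrite -hA => /imsetP[i _ e]; apply/existsP; exists i; apply/eqP/gi.
    by rewrite e hE.
  - apply/forallP=> i; apply/forallP=> j; apply/andP; split; apply/implyP.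
      by move/h1; rewrite !hE g2.
    by rewrite -g1 => e; apply: h2; rewrite !hE.
move=> f f' /ffunP e; apply/ffunP=> i; apply: gi.
by have := e i; rewrite !ffunE.
Qed.

Lemma card_pictures_iso P P' A : diso P P' -> #|pictures P A| = #|pictures P' A|.
Proof.
suff le P1 P2 : diso P1 P2 -> (#|pictures P1 A| <= #|pictures P2 A|)%N.
  by move=> i; apply/eqP; rewrite eqn_leq !le // diso_sym.
move=> /diso_sym/disoP[g [[g' gK g'K] g1 g2]].
rewrite -(card_imset _ (_ : injective (fun f : {ffun P1 -> Z} => [ffun i => f (g i)]))).
  apply/subset_leq_card/subsetP=> _ /imsetP[f /picturesP[fA f1 f2] ->].
  apply/picturesP; split.
  - rewrite -fA; apply/setP=> z; apply/imsetP/imsetP => -[x _ ->].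
      by exists (g x); rewrite ?ffunE.
    by exists (g' x); rewrite ?ffunE ?g'K.
  - by move=> i j; rewrite !ffunE -g1; apply: f1.
  - by move=> i j; rewrite !ffunE -g2; apply: f2.
move=> f f' /ffunP e; apply/ffunP=> i.
by have := e (g' i); rewrite !ffunE g'K.
Qed.

(** A picture of the concatenation is cut along the image I of the second factor.
I is an ideal: an element of A that is above one of I for [le1] comes from an
element that is above one of Q for [le2], hence from Q.  Conversely two pictures
glue along any ideal, since no [le1]-relation of the concatenation mixes the
factors and all mixed [le2]-relations go from P to Q. *)
Lemma card_pictures_prod P Q A :
  #|pictures (dprod P Q) A| =
  (\sum_(I | ideal_in A I) #|pictures P (A :\: I)| * #|pictures Q I|)%N.
Proof.
pose glue (p : {ffun P -> Z} * {ffun Q -> Z}) : {ffun dprod P Q -> Z} :=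
  [ffun x : dprod P Q => match x with inl i => p.1 i | inr j => p.2 j end].
have glue_inj : injective glue.
  move=> [f g] [f' g'] /ffunP e; congr pair; apply/ffunP=> i.
    by have := e (inl i); rewrite !ffunE.
  by have := e (inr i); rewrite !ffunE.
pose top (f : {ffun dprod P Q -> Z}) : {set Z} := [set f (inr j) | j in [set: Q]].
rewrite -sum1_card (partition_big top (ideal_in A)) /=; last first.
  move=> f /(@picturesP (dprod P Q))[fA f1 f2].
  apply/ideal_inP; split=> [|x y].
    by apply/subsetP=> _ /imsetP[j _ ->]; rewrite -fA imset_f.
  move=> /imsetP[j _ ->]; rewrite -fA => /imsetP[[i|k] _ ->] //.
    by move/f2.
  by move=> _; apply/imsetP; exists k.
apply: eq_bigr => I /ideal_inP[IA Iup].
rewrite -cardsX -(card_imset _ glue_inj) -sum1_card; apply: eq_bigl => f.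
apply/andP/imsetP => [[fP /eqP fI]|[[g h] + ->]].
  have fi := @picture_inj (dprod P Q) _ _ fP; case/(@picturesP (dprod P Q)): fP => fA f1 f2.
  exists ([ffun i => f (inl i)], [ffun j => f (inr j)]); last first.
    by apply/ffunP=> -[i|j]; rewrite !ffunE.
  rewrite in_setX; apply/andP; split; apply/picturesP; split.
  - apply/setP=> z; apply/imsetP/idP => [[i _ ->]|].
      rewrite !inE ffunE -fA imset_f // andbT -fI.
      by apply/negP=> /imsetP[j _ /fi].
    rewrite !inE -fI -fA => /andP[zI /imsetP[[i|j] _ zE]].
      by exists i; rewrite ?ffunE.
    by case/negP: zI; rewrite zE; apply/imsetP; exists j.
  - by move=> i j ij; rewrite !ffunE; apply: f1.
  - by move=> i j; rewrite !ffunE => /f2.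
  - by rewrite -fI; apply: eq_imset => j; rewrite ffunE.
  - by move=> i j ij; rewrite !ffunE; apply: f1.
  - by move=> i j; rewrite !ffunE => /f2.
rewrite in_setX /= => /andP[gP hP].
have gin i := picture_in i gP; have hin j := picture_in j hP.
case/picturesP: gP => gA g1 g2; case/picturesP: hP => hA h1 h2.
split; last first.
  by rewrite -hA; apply/eqP/eq_imset=> j; rewrite ffunE.
apply/(@picturesP (dprod P Q)); split.
- apply/setP=> z; apply/imsetP/idP => [[[i|j] _ ->]|zA]; rewrite ?ffunE /=.
  + by have := gin i; rewrite inE => /andP[].
  + exact: (subsetP IA).
  have [|zI] := boolP (z \in I).
    by rewrite -hA => /imsetP[j _ ->]; exists (inr j); rewrite ?ffunE.
  have : z \in A :\: I by rewrite inE zI.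
  by rewrite -gA => /imsetP[i _ ->]; exists (inl i); rewrite ?ffunE.
- by case=> i [] j; rewrite !ffunE //=; auto.
- case=> i [] j; rewrite !ffunE //=; auto.
  have := gin j; rewrite inE => /andP[jI jA] ij.
  by case/negP: jI; apply: Iup ij.
Qed.

(** The root is below everything for [le1], so its image is below all of A for
[le2] and is s.  Conversely sending the root to s is compatible with the
conditions because s is minimal for [le1] in A. *)
Lemma card_pictures_graft P A s :
  (forall x y : Z, le1 x y -> le2 x y) -> least_in A s ->
  #|pictures (dgraft P) A| = #|pictures P (A :\ s)|.
Proof.
move=> le12 /least_inP[sA sl].
have /porderP[r2 a2 _] := le2_po Z.
pose ext (f : {ffun P -> Z}) : {ffun dgraft P -> Z} :=
  [ffun x : dgraft P => if x is Some i then f i else s].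
have ext_inj : injective ext.
  move=> f f' /ffunP e; apply/ffunP=> i.
  by have := e (Some i); rewrite !ffunE.
rewrite -(card_imset _ ext_inj); apply: eq_card => f.
apply/idP/imsetP => [fP|[g gP ->]].
  have fi := @picture_inj (dgraft P) _ _ fP; case/(@picturesP (dgraft P)): fP => fA f1 f2.
  have fs : f None = s.
    apply: a2; rewrite sl -?fA ?imset_f //.
    by move: sA; rewrite -fA => /imsetP[x _ ->]; rewrite f1.
  exists [ffun i => f (Some i)]; last by apply/ffunP=> -[i|]; rewrite !ffunE.
  apply/picturesP; split.
  - apply/setP=> z; rewrite !inE -fA -fs; apply/imsetP/andP => [[i _ ->]|].
      rewrite ffunE imset_f //; split=> //; apply/negP=> /eqP.
      by move/fi.
    by case=> + /imsetP[[i|] _ zE]; rewrite zE ?eqxx // => _; exists i; rewrite ?ffunE.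
  - by move=> i j ij; rewrite !ffunE; apply: f1.
  - by move=> i j; rewrite !ffunE => /f2.
have gin i := picture_in i gP; case/picturesP: gP => gA g1 g2.
have gs i : (g i != s) /\ (g i \in A) by have := gin i; rewrite !inE => /andP.
apply/(@picturesP (dgraft P)); split.
- apply/setP=> z; apply/imsetP/idP => [[[i|] _ ->]|zA]; rewrite ?ffunE //.
    by case: (gs i).
  have [->|zs] := eqVneq z s; first by exists None; rewrite ?ffunE.
  have : z \in A :\ s by rewrite !inE zs.
  by rewrite -gA => /imsetP[i _ ->]; exists (Some i); rewrite ?ffunE.
- case=> [i|] [j|]; rewrite !ffunE //=; auto.
  by move=> _; apply: sl; case: (gs j).
- case=> [i|] [j|]; rewrite !ffunE //=; auto.
  have [gis giA] := gs i; move/le12=> h; case/eqP: gis; apply: a2.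
  by rewrite h sl.
Qed.

Lemma card_pictures_empty A : A != set0 -> #|pictures dempty A| = 0%N.
Proof.
case/set0Pn=> z zA; apply: eq_card0 => f; apply/negbTE/negP=> /picturesP[fA _ _].
by move: zA; rewrite -fA => /imsetP[[]].
Qed.

Lemma card_pictures_set0 P : (0 < #|P|)%N -> #|pictures P set0| = 0%N.
Proof.
case/card_gt0P=> i _; apply: eq_card0 => f; apply/negbTE/negP=> /(picture_in i).
by rewrite inE.
Qed.

End Pictures.

(** * Linear forms counting pictures *)

Section PictureForm.
Variables (K : fieldType) (Z : dposet).
Implicit Types (A I J : {set Z}) (x y : {malg K[dclass]}).

Definition picture_form A : {malg K[dclass]} -> K^o :=
  lin (fun c => #|pictures (rep c) A|%:R : K^o).

Lemma picture_formU A P : picture_form A << cls P >> = #|pictures P A|%:R.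
Proof. by rewrite /picture_form linU (card_pictures_iso _ (cls_rep P)). Qed.

Lemma picture_formD A x y : picture_form A (x + y) = picture_form A x + picture_form A y.
Proof. exact: linearD. Qed.
Lemma picture_formB A x y : picture_form A (x - y) = picture_form A x - picture_form A y.
Proof. exact: linearB. Qed.
Lemma picture_formZ A k x : picture_form A (k *: x) = k * picture_form A x.
Proof. exact: linearZ. Qed.
Lemma picture_form0 A : picture_form A 0 = 0.
Proof. exact: linear0. Qed.

Lemma picture_form_mul A x y :
  picture_form A (x * y) =
  \sum_(I | ideal_in A I) picture_form (A :\: I) x * picture_form I y.
Proof.
elim/malg_ind: x => [|c|x x' IH IH'|k x IH].
- by rewrite mul0r picture_form0 big1 // => I _; rewrite picture_form0 mul0r.
- elim/malg_ind: y => [|d|y y' IH IH'|k y IH].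
  + by rewrite mulr0 picture_form0 big1 // => I _; rewrite picture_form0 mulr0.
  + rewrite mulU -[c]repK -[d]repK cprodE picture_formU card_pictures_prod natr_sum.
    by apply: eq_bigr => I _; rewrite natrM !picture_formU.
  + rewrite mulrDr picture_formD IH IH' -big_split; apply: eq_bigr => I _.
    by rewrite picture_formD mulrDr.
  + rewrite malgAr picture_formZ IH mulr_sumr; apply: eq_bigr => I _.
    by rewrite picture_formZ mulrCA.
- rewrite mulrDl picture_formD IH IH' -big_split; apply: eq_bigr => I _.
  by rewrite picture_formD mulrDl.
- rewrite -scalerAl picture_formZ IH mulr_sumr; apply: eq_bigr => I _.
  by rewrite picture_formZ mulrA.
Qed.

Hypothesis le12 : forall x y : Z, le1 x y -> le2 x y.
(* Opaque names, so that rewriting does not unfold the operators. *)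
Variables (B : {malg K[dclass]} -> {malg K[dclass]}) (BE : B = @Bplus K).
Variables (pr : {malg K[dclass]} -> {malg K[dclass]} -> {malg K[dclass]}).
Variable (pE : pr = @dend_prec K).

Lemma picture_form_graft A s x : least_in A s ->
  picture_form A (B x) = picture_form (A :\ s) x.
Proof.
move=> As; elim/malg_ind: x => [|c|x y IHx IHy|k x IH].
- by rewrite (B0 BE) !picture_form0.
- by rewrite (BU BE) -[c]repK cgraftE !picture_formU (card_pictures_graft _ le12 As).
- by rewrite (BD BE) !picture_formD IHx IHy.
- by rewrite (BZ BE) !picture_formZ IH.
Qed.

(** The heart of the proof: the first identity, for every subset A with a least
element s.  All the A are needed at once, as the induction hypothesis is
applied to the ideals J of A that contain s. *)
Lemma picture_form_prec A s c (d : dclass) : isF c -> least_in A s ->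
  picture_form A (pr << c >> << d >>) =
  \sum_(I | ideal_in A I && (s \notin I))
     picture_form (A :\: I) << c >> * picture_form I << d >>.
Proof.
move=> Fc; elim: Fc A => [|a f Ff IH] A As; have /least_inP[sA sl] := As.
  rewrite (prec_one pE) picture_form0 big1 // => I /andP[_ sI].
  rewrite picture_formU card_pictures_empty ?mul0r //.
  by apply/set0Pn; exists s; rewrite inE sI.
rewrite -mulU (prec_stepU BE pE) // addrAC -(BN BE) -(BD BE) -mulrBr.
rewrite picture_formD (picture_form_graft _ As) !picture_form_mul.
rewrite (eq_bigl _ _ (fun J => ideal_in_D1 J le12 As)).
(* Align the two sums over J: the first only has the J avoiding s. *)
rewrite [X in _ + X](bigID (fun J => s \notin J)) /= addrA -big_split /=.
have AJ J : ideal_in A J && (s \notin J) ->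
    picture_form ((A :\ s) :\: J) << a >> = picture_form (A :\: J) << cgraft a >>.
  case/andP=> _ sJ; rewrite -(BU BE) (@picture_form_graft _ s).
    by rewrite !setDDl setUC.
  by apply: least_in_sub As; rewrite ?subsetDl // inE sJ.
transitivity (\sum_(J | ideal_in A J) \sum_(I | ideal_in J I)
   (if s \notin I then picture_form (A :\: J) << cgraft a >> *
      picture_form (J :\: I) << f >> * picture_form I << d >> else 0)).
  (* For s outside J every ideal of J avoids s, and the term is that of the
     product fd; for s in J the induction hypothesis gives the term. *)
  rewrite [RHS](bigID (fun J => s \notin J)) /=; congr (_ + _); apply: eq_bigr => J.
    move=> hJ; rewrite AJ // -mulrDr picture_formB subrK picture_form_mul mulr_sumr.
    apply: eq_bigr => I /ideal_inP[IJ _]; case/andP: hJ => _ sJ.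
    by rewrite (contra (subsetP IJ s) sJ) mulrA.
  case/andP=> /ideal_inP[JA _]; rewrite negbK => sJ.
  rewrite (IH J); last exact: least_in_sub As.
  by rewrite mulr_sumr big_mkcondr /=; apply: eq_bigr => I _; case: ifP; rewrite ?mulrA.
rewrite (sum_ideal_chain A (fun S T I => if s \notin I then picture_form S << cgraft a >> *
      picture_form T << f >> * picture_form I << d >> else 0)).
rewrite [RHS]big_mkcondr; apply: eq_bigr => I _.
case: ifP => _; last by rewrite big1.
by rewrite picture_form_mul mulr_suml.
Qed.

End PictureForm.

(** * Special plane forests as targets *)

Section SpecialPlaneForests.
Implicit Type P : dposet.

Lemma spf_le12 P : special_plane_forest P -> forall x y : P, le1 x y -> le2 x y.
Proof. by case=> ler [_ h] x y xy; rewrite h xy. Qed.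

Lemma spf_least P : special_plane_forest P -> cls P <> cempty -> exists s : P, leastb s.
Proof.
move=> spf P0; have [TE] := spf_decomp_aux spf P0; rewrite TE.
rewrite -[cA (cls P)]repK -[cF' (cls P)]repK cgraftE cprodE.
move/clsP/diso_sym/disoP=> [f [fb _ f2]].
exists (f (inl None)); rewrite (least_iso fb f2).
by apply/forallP=> -[[]|].
Qed.

End SpecialPlaneForests.

(** * The duality, on the basis and by linearity *)

Section Duality.
Variable K : fieldType.
Local Notation H := {malg K[dclass]}.
Implicit Types (c d e : dclass) (x y z : H).

Lemma eq_lin (T : choiceType) (V : lmodType K) (f g : T -> V) :
  f =1 g -> lin f =1 lin g.
Proof. by move=> fg u; apply: eq_bigr => c _; rewrite fg. Qed.

Lemma bilinU (T U : choiceType) (V : lmodType K) (f : T -> U -> V) u (c : U) :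
  bilin f u << c >> = lin (f^~ c) u.
Proof. by apply: eq_lin => b; apply: linU. Qed.

Lemma pairing_form x e : pairing x << e >> = picture_form (Z := rep e) setT x.
Proof.
rewrite [LHS]bilinU /picture_form; apply: (@eq_lin dclass K^o) => c.
rewrite /cpair (@card_pictures (rep e) _ _ setT id) //.
by apply/setP=> u; rewrite inE; apply/imsetP; exists u.
Qed.

Lemma cpair_form (Z : dposet) (I : {set Z}) c :
  cpair K c (cls (drestr I)) = picture_form I << c >>.
Proof.
rewrite -{2}[c]repK picture_formU /cpair.
have /disoP[f [[f' fK f'K] f1 f2]] := cls_rep (drestr I).
rewrite (@card_pictures Z _ _ I (fun u => val (f u))) //.
apply/setP=> u; apply/imsetP/idP => [[v _ ->]|uI]; first exact: (valP (f v)).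
by exists (f' (Sub u uI)); rewrite ?f'K.
Qed.

Lemma pairing2_Delta_part b c d e :
  pairing2 (tens << c >> << d >>) (Delta_part K b e) =
  \sum_(I : {set rep e} | [&& I != set0, I != setT, ideal1 I & has_least I == b])
     picture_form (setT :\: I) (<< c >> : H) * picture_form I (<< d >> : H).
Proof.
have -> : tens << c >> << d >> = << (c, d) >> :> {malg K[(dclass * dclass)%type]}.
  by rewrite /tens /bilin !linU.
rewrite /pairing2 /bilin linU /Delta_part linear_sum; apply: eq_bigr => I _.
by rewrite /= [LHS]linU /= !cpair_form setTD.
Qed.

(** The trivial ideals may be added to the sum since a nonempty forest has no
picture onto the empty set. *)
Lemma Delta_part_least b c d e (s : rep e) : leastb s ->
  c <> cempty -> d <> cempty ->
  pairing2 (tens << c >> << d >>) (Delta_part K b e) =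
  \sum_(I | ideal_in setT I && ((s \in I) == b))
     picture_form (setT :\: I) (<< c >> : H) * picture_form I (<< d >> : H).
Proof.
move=> sl c0 d0; rewrite pairing2_Delta_part.
have form0 f : f <> cempty -> picture_form (@set0 (rep e)) (<< f >> : H) = 0.
  move=> /eqP; rewrite -dcard_eq0 -lt0n => f0.
  by rewrite -[f]repK picture_formU card_pictures_set0 // mulr0n.
have hl I : has_least I = (s \in I).
  by apply/exists_inP/idP => [[t tI tl]|sI]; [rewrite (least_uniq sl tl) | exists s].
rewrite [RHS](bigID (fun I => (I != set0) && (I != setT))) /= [X in _ + X]big1.
  rewrite addr0; apply: eq_bigl => I; rewrite ideal_in_setT hl.
  by case: (I != set0); case: (I != setT); rewrite ?andbT ?andbF.
move=> I /andP[_]; rewrite negb_and !negbK => /orP[]/eqP->.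
  by rewrite form0 // mulr0.
by rewrite setDv form0 // mul0r.
Qed.

Lemma duality_basis c d e : special_plane_forest (rep c) -> special_plane_forest (rep e) ->
  c <> cempty -> d <> cempty -> e <> cempty ->
  pairing (dend_prec << c >> << d >>) << e >> =
    pairing2 (tens << c >> << d >>) (Delta_part K false e) /\
  pairing (dend_succ << c >> << d >>) << e >> =
    pairing2 (tens << c >> << d >>) (Delta_part K true e).
Proof.
move=> cF eF c0 d0 e0; have [|s sl] := spf_least eF; first by rewrite repK.
have sT : least_in setT s.
  by apply/least_inP; split=> // y _; move/forallP: sl.
have precE := picture_form_prec (spf_le12 eF) (erefl (@Bplus K)) (erefl (@dend_prec K))
  d (spf_isF cF) sT.
rewrite !(Delta_part_least _ sl) // !pairing_form /dend_succ picture_formB.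
rewrite picture_form_mul precE; split.
  by apply: eq_bigl => I; rewrite eqbF_neg.
rewrite (bigID (fun I : {set rep e} => s \notin I)) /= addrC addrK.
by apply: eq_bigl => I; rewrite negbK eqb_id.
Qed.

Lemma HSPFplus_ind (Q : H -> Prop) :
  Q 0 -> (forall c, special_plane_forest (rep c) -> c <> cempty -> Q << c >>) ->
  (forall k x y, Q x -> Q y -> Q (k *: x + y)) ->
  forall x, HSPFplus x -> Q x.
Proof.
move=> Q0 QU QP x xF; rewrite (monalgE x) big_seq.
elim/big_rec: _ => // c y cx Qy; have [cF c0] := xF c cx.
have -> : << x@_c *g c >> = x@_c *: << c >> :> H.
  by apply/malgP=> d; rewrite mcoeffZ !mcoeffU mulr_natr.
exact/QP/Qy/QU.
Qed.

Lemma trilinear_eq0 (T : H -> H -> H -> K^o) :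
  (forall y z, linear (fun x => T x y z)) ->
  (forall x z, linear (fun y => T x y z)) ->
  (forall x y, linear (T x y)) ->
  (forall c d e, special_plane_forest (rep c) -> special_plane_forest (rep e) ->
     c <> cempty -> d <> cempty -> e <> cempty -> T << c >> << d >> << e >> = 0) ->
  forall x y z, HSPFplus x -> HSPFplus y -> HSPFplus z -> T x y z = 0.
Proof.
have lin0 (f : H -> K^o) : linear f -> f 0 = 0.
  by move=> fl; have := fl (-1) 0 0; rewrite scaler0 addr0 scaleN1r addNr.
move=> T1 T2 T3 TU x y z xF yF zF.
elim/HSPFplus_ind: x / xF => [|c cF c0|k x x' IH IH']; first exact: (lin0 _ (T1 y z)).
  elim/HSPFplus_ind: y / yF => [|d dF d0|k y y' IH IH']; first exact: (lin0 _ (T2 _ z)).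
    elim/HSPFplus_ind: z / zF => [|e eF e0|k z z' IH IH']; first exact: (lin0 _ (T3 _ _)).
      exact: TU.
    by rewrite T3 IH IH' scaler0 addr0.
  by rewrite (T2 _ z) IH IH' scaler0 addr0.
by rewrite (T1 y z) IH IH' scaler0 addr0.
Qed.

Lemma pairing_linear_l z : linear (fun x => pairing x z : K^o).
Proof. exact: bilin_linear_l. Qed.

Lemma pairing_linear_r x : linear (fun z => pairing x z : K^o).
Proof. exact: bilin_linear_r. Qed.

Lemma tens_linear_l y : linear (fun x => tens x y).
Proof. exact: bilin_linear_l. Qed.

Lemma tens_linear_r x : linear (tens x).
Proof. exact: bilin_linear_r. Qed.

Lemma pairing2_linear_l w : linear (fun v => pairing2 (K := K) v w : K^o).
Proof. exact: bilin_linear_l. Qed.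

Lemma pairing2_linear_r v : linear (fun w => pairing2 (K := K) v w : K^o).
Proof. exact: bilin_linear_r. Qed.

Lemma subr_linear (V : lmodType K) k (u u' v v' : V) :
  (k *: u + u') - (k *: v + v') = k *: (u - v) + (u' - v').
Proof. by rewrite scalerBr opprD addrACA. Qed.

Lemma adjoint_of_basis b (op : H -> H -> H) :
  (forall y, linear (op^~ y)) -> (forall x, linear (op x)) ->
  (forall c d e, special_plane_forest (rep c) -> special_plane_forest (rep e) ->
     c <> cempty -> d <> cempty -> e <> cempty ->
     pairing (op << c >> << d >>) << e >> =
     pairing2 (tens << c >> << d >>) (Delta_part K b e)) ->
  forall x y z, HSPFplus x -> HSPFplus y -> HSPFplus z ->
  pairing (op x y) z = pairing2 (tens x y) (lin (Delta_part K b) z).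
Proof.
move=> opl opr opU x y z xF yF zF; apply/eqP; rewrite -subr_eq0; apply/eqP.
pose T x y z : K^o := pairing (op x y) z - pairing2 (tens x y) (lin (Delta_part K b) z).
apply: (@trilinear_eq0 T _ _ _ _ x y z xF yF zF).
- move=> v w k u u'; rewrite /T opl tens_linear_l pairing_linear_l pairing2_linear_l.
  exact: (@subr_linear K^o).
- move=> v w k u u'; rewrite /T opr tens_linear_r pairing_linear_l pairing2_linear_l.
  exact: (@subr_linear K^o).
- move=> v w k u u'; rewrite /T linearP pairing_linear_r pairing2_linear_r.
  exact: (@subr_linear K^o).
- by move=> c d e cF eF c0 d0 e0; rewrite /T opU // [lin _ _]linU subrr.
Qed.

Lemma dend_prec_linear_l y : linear (fun x => dend_prec x y).
Proof. exact: bilin_linear_l. Qed.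

Lemma dend_prec_linear_r x : linear (dend_prec x).
Proof. exact: bilin_linear_r. Qed.

Lemma dend_succ_linear_l y : linear (fun x => dend_succ x y).
Proof.
move=> k x x'; rewrite /dend_succ dend_prec_linear_l mulrDl -scalerAl.
exact: subr_linear.
Qed.

Lemma dend_succ_linear_r x : linear (dend_succ x).
Proof.
move=> k y y'; rewrite /dend_succ dend_prec_linear_r mulrDr malgAr.
exact: subr_linear.
Qed.

End Duality.

Theorem lemma6p5 (K : fieldType) (x y z : {malg K[dclass]}) :
  HSPFplus x -> HSPFplus y -> HSPFplus z ->
  pairing (dend_prec x y) z = pairing2 (tens x y) (Delta_prec z) /\
  pairing (dend_succ x y) z = pairing2 (tens x y) (Delta_succ z).
Proof.
move=> xF yF zF; split; apply: adjoint_of_basis => //.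
- exact: dend_prec_linear_l.
- exact: dend_prec_linear_r.
- by move=> c d e cF eF c0 d0 e0; case: (duality_basis K cF eF c0 d0 e0).
- exact: dend_succ_linear_l.
- exact: dend_succ_linear_r.
- by move=> c d e cF eF c0 d0 e0; case: (duality_basis K cF eF c0 d0 e0).
Qed.
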